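(* Let $n\ge 2$ be an even integer, let $\mathcal{A}$ be an additive category, let $T\colon\mathcal{A}\to\mathcal{A}$ be an additive functor, and let $\omega\colon \mathrm{Id}_{\mathcal{A}}\to T$ be a natural transformation with $\omega_{T(X)}=T(\omega_X)$ for every object $X\in\mathcal{A}$. Let $\nabla$ be the class of all sixtuples in $\mathrm{HFact}_n(\mathcal{A},T,\omega)$ that are isomorphic to one of the form $$X \xrightarrow{[f]} Y \xrightarrow{[i_f]} C_f \xrightarrow{[\pi_f]} \Sigma X$$ for a morphism $f\colon X\to Y$ in $\mathrm{Fact}_n(\mathcal{A},T,\omega)$. Then the homotopy category $\mathrm{HFact}_n(\mathcal{A},T,\omega)$ of $n$-fold $(\mathcal{A},T)$-factorizations of $\omega$, equipped with the suspension functor $\Sigma$ and the class $\nabla$, is a right triangulated category.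
   Context: **Factorizations.** An $n$-fold $(\mathcal{A},T)$-factorization $X=(X^j,d_X^j)$ of $\omega$ is a sequence $X^0\xrightarrow{d_X^0}X^1\xrightarrow{d_X^1}\cdots\xrightarrow{d_X^{n-2}}X^{n-1}\xrightarrow{d_X^{n-1}}T(X^0)$ in $\mathcal{A}$ such that every $n$-fold composition is the corresponding component of $\omega$: $d_X^{n-1}\circ\cdots\circ d_X^0=\omega_{X^0}$, and $T(d_X^{j-1})\circ\cdots\circ T(d_X^0)\circ d_X^{n-1}\circ\cdots\circ d_X^{j}=\omega_{X^j}$ for $1\le j\le n-1$. A morphism $f\colon X\to Y$ is a sequence $(f^0,\dots,f^{n-1})$ of morphisms $f^j\colon X^j\to Y^j$ in $\mathcal{A}$ with $f^{j+1}d_X^j=d_Y^jf^j$ for $0\le j\le n-2$ and $T(f^0)d_X^{n-1}=d_Y^{n-1}f^{n-1}$. With componentwise composition and addition these form the additive category $\mathrm{Fact}_n(\mathcal{A},T,\omega)$. **Homotopy.** Morphisms $f,g\colon X\to Y$ are homotopic, $f\sim g$, if there are morphisms $s^j\colon X^{j+1}\to Y^j$ ($0\le j\le n-2$) and $s^{n-1}\colon T(X^0)\to Y^{n-1}$ in $\mathcal{A}$ with $T(f^0-g^0)=d_Y^{n-1}s^{n-1}+T(s^0d_X^0)$ and $f^j-g^j=d_Y^{j-1}s^{j-1}+s^jd_X^j$ for $1\le j\le n-1$. This is an equivalence relation compatible with addition and composition; $[f]$ is the class of $f$. The homotopy category $\mathrm{HFact}_n(\mathcal{A},T,\omega)$ has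 the same objects as $\mathrm{Fact}_n(\mathcal{A},T,\omega)$ and homotopy classes as morphisms. **Suspension.** $\Sigma X$ is $X^1\xrightarrow{-d_X^1}X^2\to\cdots\to X^{n-1}\xrightarrow{-d_X^{n-1}}T(X^0)\xrightarrow{-T(d_X^0)}T(X^1)$, and $\Sigma f=(f^1,\dots,f^{n-1},T(f^0))$. This induces an additive endofunctor $\Sigma$ of $\mathrm{HFact}_n(\mathcal{A},T,\omega)$. **Mapping cone.** For $f\colon X\to Y$, the cone $C_f$ is the factorization with components those of $\Sigma X\oplus Y$, $$X^1\oplus Y^0\to X^2\oplus Y^1\to\cdots\to T(X^0)\oplus Y^{n-1}\to T(X^1)\oplus T(Y^0),$$ with differentials $d_{C_f}^j=\begin{bmatrix}-d_X^{j+1}&0\\ f^{j+1}&d_Y^j\end{bmatrix}$ for $0\le j\le n-2$ and $d_{C_f}^{n-1}=\begin{bmatrix}-T(d_X^0)&0\\ T(f^0)&d_Y^{n-1}\end{bmatrix}$. The morphism $i_f\colon Y\to C_f$ is $\begin{bmatrix}0\\1\end{bmatrix}$ in each component, and $\pi_f\colon C_f\to\Sigma X$ is $\begin{bmatrix}1&0\end{bmatrix}$ in each component. **Right triangulated category.** Let $\mathcal{C}$ be an additive category with an additive functor $\Sigma\colon\mathcal{C}\to\mathcal{C}$. A sixtuple is a sequence $X\xrightarrow{f}Y\xrightarrow{g}Z\xrightarrow{h}\Sigma X$ in $\mathcal{C}$. A morphism of sixtuples from $(X_1,Y_1,Z_1,f_1,g_1,h_1)$ to $(X_2,Y_2,Z_2,f_2,g_2,h_2)$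 is a triple $(\alpha,\beta,\gamma)$ with $\beta f_1=f_2\alpha$, $\gamma g_1=g_2\beta$, $\Sigma(\alpha)h_1=h_2\gamma$; it is an isomorphism if $\alpha,\beta,\gamma$ are. $(\mathcal{C},\Sigma,\nabla)$, with $\nabla$ a class of sixtuples, is right triangulated if: (RTR1) (a) $\nabla$ is closed under isomorphism of sixtuples; (b) every morphism $f\colon X\to Y$ occurs as the first morphism of a sixtuple $X\xrightarrow{f}Y\to Z\to\Sigma X$ in $\nabla$; (c) for every $X$ the sixtuple $X\xrightarrow{1_X}X\to0\to\Sigma X$ is in $\nabla$. (RTR2) If $X\xrightarrow{f}Y\xrightarrow{g}Z\xrightarrow{h}\Sigma X$ is in $\nabla$, so is $Y\xrightarrow{g}Z\xrightarrow{h}\Sigma X\xrightarrow{-\Sigma f}\Sigma Y$. (RTR3) If $(X_i,Y_i,Z_i,f_i,g_i,h_i)$, $i=1,2$, are in $\nabla$ and $\alpha\colon X_1\to X_2$, $\beta\colon Y_1\to Y_2$ satisfy $\beta f_1=f_2\alpha$, there is $\gamma\colon Z_1\to Z_2$ such that $(\alpha,\beta,\gamma)$ is a morphism of sixtuples. (RTR4) (octahedral axiom) If $X_1\xrightarrow{f_1}Y_1\xrightarrow{g_1}Z_1\xrightarrow{h_1}\Sigma X_1$, $X_1\xrightarrow{\beta_1f_1}Y_2\xrightarrow{g_2}Z_2\xrightarrow{h_2}\Sigma X_1$ and $Y_1\xrightarrow{\beta_1}Y_2\xrightarrow{\beta_2}Y_3\xrightarrow{\beta_3}\Sigma Y_1$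 are in $\nabla$, there are $\gamma_1\colon Z_1\to Z_2$ and $\gamma_2\colon Z_2\to Y_3$ with $\gamma_1g_1=g_2\beta_1$, $h_2\gamma_1=h_1$, $\gamma_2g_2=\beta_2$, $\beta_3\gamma_2=\Sigma(f_1)h_2$, and such that $Z_1\xrightarrow{\gamma_1}Z_2\xrightarrow{\gamma_2}Y_3\xrightarrow{\Sigma(g_1)\beta_3}\Sigma Z_1$ is in $\nabla$. *)

(* Defs.v *)
From HB Require Import structures.
From mathcomp Require Import all_boot all_order all_algebra.
From mathcomp Require Import boolp.

Set Implicit Arguments.
Unset Strict Implicit.
Unset Printing Implicit Defensive.

Import GRing.Theory.

Declare Scope cat_scope.
Delimit Scope cat_scope with cat.
Local Open Scope quotient_scope.
Local Open Scope ring_scope.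
Local Open Scope cat_scope.

Reserved Notation "g ∘ f" (at level 40, left associativity).

(* The zero object and the binary biproducts are chosen data. *)
Record additive_category := AdditiveCategory {
  ob :> Type;
  Hom : ob -> ob -> zmodType;
  idm : forall A, Hom A A;
  mcomp : forall A B C, Hom B C -> Hom A B -> Hom A C
    where "g ∘ f" := (mcomp g f);
  mcompA : forall A B C D (h : Hom C D) (g : Hom B C) (f : Hom A B),
    h ∘ (g ∘ f) = (h ∘ g) ∘ f;
  comp_idl : forall A B (f : Hom A B), idm B ∘ f = f;
  comp_idr : forall A B (f : Hom A B), f ∘ idm A = f;
  mcompDl : forall A B C (g1 g2 : Hom B C) (f : Hom A B),
    (g1 + g2) ∘ f = g1 ∘ f + g2 ∘ f;
  mcompDr : forall A B C (g : Hom B C) (f1 f2 : Hom A B),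
    g ∘ (f1 + f2) = g ∘ f1 + g ∘ f2;
  zob : ob;
  zob_initial : forall A (f : Hom zob A), f = 0;
  zob_terminal : forall A (f : Hom A zob), f = 0;
  bip : ob -> ob -> ob;
  inj1 : forall A B, Hom A (bip A B);
  inj2 : forall A B, Hom B (bip A B);
  prj1 : forall A B, Hom (bip A B) A;
  prj2 : forall A B, Hom (bip A B) B;
  prj1_inj1 : forall A B, prj1 A B ∘ inj1 A B = idm A;
  prj2_inj2 : forall A B, prj2 A B ∘ inj2 A B = idm B;
  prj1_inj2 : forall A B, prj1 A B ∘ inj2 A B = 0;
  prj2_inj1 : forall A B, prj2 A B ∘ inj1 A B = 0;
  bip_id : forall A B,
    inj1 A B ∘ prj1 A B + inj2 A B ∘ prj2 A B = idm (bip A B)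
}.

Arguments Hom {a} A B : rename.
Arguments idm {a} A : rename.
Arguments mcomp {a} [A B C] g f : rename.
Arguments zob {a} : rename.
Arguments bip {a} A B : rename.
Arguments inj1 {a} {A B} : rename.
Arguments inj2 {a} {A B} : rename.
Arguments prj1 {a} {A B} : rename.
Arguments prj2 {a} {A B} : rename.
Notation "g ∘ f" := (mcomp g f) : cat_scope.

Record additive_functor (C D : additive_category) := AdditiveFunctor {
  fobj :> C -> D;
  fmap : forall A B : C, Hom A B -> Hom (fobj A) (fobj B);
  fmap_id : forall A, fmap (idm A) = idm (fobj A);
  fmap_comp : forall (A B E : C) (g : Hom B E) (f : Hom A B),
    fmap (g ∘ f) = fmap g ∘ fmap f;
  fmapD : forall (A B : C) (f g : Hom A B), fmap (f + g) = fmap f + fmap g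
}.

Arguments fmap {C D} a [A B] f : rename.

Definition id_functor (C : additive_category) : additive_functor C C :=
  @AdditiveFunctor C C id (fun _ _ => id)
    (fun _ => erefl) (fun _ _ _ _ _ => erefl) (fun _ _ _ _ => erefl).

Record nat_trans (C D : additive_category) (F G : additive_functor C D) :=
  NatTrans {
    component :> forall X, Hom (F X) (G X);
    naturality : forall X Y (f : Hom X Y),
      component Y ∘ fmap F f = fmap G f ∘ component X
  }.

Section Arithmetic.
Variable C : additive_category.

Lemma comp0m (A B E : C) (f : Hom A B) : (0 : Hom B E) ∘ f = 0.
Proof. by apply: (@addrI _ (0 ∘ f)); rewrite -mcompDl !addr0. Qed.

Lemma compm0 (A B E : C) (f : Hom B E) : f ∘ (0 : Hom A B) = 0.
Proof. by apply: (@addrI _ (f ∘ 0)); rewrite -mcompDr !addr0. Qed.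

Lemma compNm (A B E : C) (g : Hom B E) (f : Hom A B) : (- g) ∘ f = - (g ∘ f).
Proof. by apply: (@addrI _ (g ∘ f)); rewrite -mcompDl !subrr comp0m. Qed.

Lemma compmN (A B E : C) (g : Hom B E) (f : Hom A B) : g ∘ (- f) = - (g ∘ f).
Proof. by apply: (@addrI _ (g ∘ f)); rewrite -mcompDr !subrr compm0. Qed.

Lemma fmap0 (D : additive_category) (F : additive_functor C D) (A B : C) :
  fmap F (0 : Hom A B) = 0.
Proof. by apply: (@addrI _ (fmap F 0)); rewrite -fmapD !addr0. Qed.

Lemma fmapN (D : additive_category) (F : additive_functor C D) (A B : C)
  (f : Hom A B) : fmap F (- f) = - fmap F f.
Proof. by apply: (@addrI _ (fmap F f)); rewrite -fmapD !subrr fmap0. Qed.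

Lemma bip_ext (A B E : C) (f g : Hom (bip A B) E) :
  f ∘ inj1 = g ∘ inj1 -> f ∘ inj2 = g ∘ inj2 -> f = g.
Proof.
by move=> e1 e2; rewrite -[f]comp_idr -[g]comp_idr -!bip_id !mcompDr !mcompA
  e1 e2.
Qed.

End Arithmetic.

Definition is_iso (C : additive_category) (A B : C) (f : Hom A B) :=
  exists g : Hom B A, g ∘ f = idm A /\ f ∘ g = idm B.

Section RightTriangulated.
Variables (C : additive_category) (Sigma : additive_functor C C).

Record sixtuple := Sixtuple {
  sX : C;
  sY : C;
  sZ : C;
  sf : Hom sX sY;
  sg : Hom sY sZ;
  sh : Hom sZ (Sigma sX)
}.

Definition sixtuple_morphism (t1 t2 : sixtuple) (a : Hom (sX t1) (sX t2))
    (b : Hom (sY t1) (sY t2)) (c : Hom (sZ t1) (sZ t2)) : Prop :=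
  [/\ b ∘ sf t1 = sf t2 ∘ a,
      c ∘ sg t1 = sg t2 ∘ b &
      fmap Sigma a ∘ sh t1 = sh t2 ∘ c].

Definition sixtuple_iso (t1 t2 : sixtuple) : Prop :=
  exists (a : Hom (sX t1) (sX t2)) (b : Hom (sY t1) (sY t2))
         (c : Hom (sZ t1) (sZ t2)),
    sixtuple_morphism a b c /\ [/\ is_iso a, is_iso b & is_iso c].

Record right_triangulated (nabla : sixtuple -> Prop) : Prop :=
  RightTriangulated {
    RTR1a : forall t1 t2, sixtuple_iso t1 t2 -> nabla t1 -> nabla t2;
    RTR1b : forall (X Y : C) (f : Hom X Y),
      exists (Z : C) (g : Hom Y Z) (h : Hom Z (Sigma X)),
        nabla (Sixtuple f g h);
    RTR1c : forall X : C,
      nabla (Sixtuple (idm X) (0 : Hom X zob) (0 : Hom zob (Sigma X)));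
    RTR2 : forall (X Y Z : C) (f : Hom X Y) (g : Hom Y Z)
        (h : Hom Z (Sigma X)),
      nabla (Sixtuple f g h) -> nabla (Sixtuple g h (- fmap Sigma f));
    RTR3 : forall t1 t2 (a : Hom (sX t1) (sX t2)) (b : Hom (sY t1) (sY t2)),
      nabla t1 -> nabla t2 -> b ∘ sf t1 = sf t2 ∘ a ->
      exists c : Hom (sZ t1) (sZ t2), sixtuple_morphism a b c;
    RTR4 : forall (X1 Y1 Z1 Y2 Z2 Y3 : C)
        (f1 : Hom X1 Y1) (g1 : Hom Y1 Z1) (h1 : Hom Z1 (Sigma X1))
        (g2 : Hom Y2 Z2) (h2 : Hom Z2 (Sigma X1))
        (b1 : Hom Y1 Y2) (b2 : Hom Y2 Y3) (b3 : Hom Y3 (Sigma Y1)),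
      nabla (Sixtuple f1 g1 h1) ->
      nabla (Sixtuple (b1 ∘ f1) g2 h2) ->
      nabla (Sixtuple b1 b2 b3) ->
      exists (c1 : Hom Z1 Z2) (c2 : Hom Z2 Y3),
        [/\ c1 ∘ g1 = g2 ∘ b1,
            h2 ∘ c1 = h1,
            c2 ∘ g2 = b2 &
            b3 ∘ c2 = fmap Sigma f1 ∘ h2] /\
        nabla (Sixtuple c1 c2 (fmap Sigma g1 ∘ b3))
  }.

End RightTriangulated.

Record congruence (C : additive_category) := Congruence {
  crel : forall X Y : C, Hom X Y -> Hom X Y -> Prop;
  crel_refl : forall X Y (f : Hom X Y), crel f f;
  crel_sym : forall X Y (f g : Hom X Y), crel f g -> crel g f;
  crel_trans : forall X Y (f g h : Hom X Y), crel f g -> crel g h -> crel f h;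
  crelD : forall X Y (f f' g g' : Hom X Y),
    crel f f' -> crel g g' -> crel (f + g) (f' + g');
  crel_comp : forall X Y Z (g g' : Hom Y Z) (f f' : Hom X Y),
    crel g g' -> crel f f' -> crel (g ∘ f) (g' ∘ f')
}.

Arguments crel {C} c [X Y] f g : rename.

Section Quotient.
Variables (C : additive_category) (R : congruence C).

Section Hom.
Variables X Y : C.

Definition qrel : rel (Hom X Y) := fun f g => `[< crel R f g >].

Lemma qrel_is_equiv : equiv_class_of qrel.
Proof.
split=> [f|f g|g f h]; rewrite /qrel.
- exact/asboolP/crel_refl.
- by apply/asbool_equiv_eq; split; exact: crel_sym.
- by move=> /asboolP fg /asboolP gh; exact/asboolP/(crel_trans fg gh).
Qed.

Canonical qrel_equiv := EquivRelPack qrel_is_equiv.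
Canonical qrel_encModRel := defaultEncModRel qrel.

Definition qhom := {eq_quot qrel}.
HB.instance Definition _ : EqQuotient (Hom X Y) qrel qhom := EqQuotient.on qhom.
HB.instance Definition _ := Choice.on qhom.

Definition cls (f : Hom X Y) : qhom := \pi f.

Lemma clsP (f g : Hom X Y) : cls f = cls g <-> crel R f g.
Proof.
split=> [/eqP|fg]; first by rewrite /cls piE => /asboolP.
by apply/eqP; rewrite /cls piE; apply/asboolP.
Qed.

Lemma cls_repr (u : qhom) : cls (repr u) = u.
Proof. exact: reprK. Qed.

Lemma repr_cls (f : Hom X Y) : crel R (repr (cls f)) f.
Proof. by apply/clsP; rewrite cls_repr. Qed.

Lemma cls_surj (u : qhom) : exists f, u = cls f.
Proof. by exists (repr u); rewrite cls_repr. Qed.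

Lemma crelN (f g : Hom X Y) : crel R f g -> crel R (- f) (- g).
Proof.
move=> fg; have := crelD (crel_refl R (- f - g)) (crel_sym fg).
by rewrite addrNK addrAC addNr add0r.
Qed.

Definition qadd (u v : qhom) : qhom := cls (repr u + repr v).
Definition qopp (u : qhom) : qhom := cls (- repr u).

Lemma qaddE f g : qadd (cls f) (cls g) = cls (f + g).
Proof. by apply/clsP/crelD; exact: repr_cls. Qed.

Lemma qoppE f : qopp (cls f) = cls (- f).
Proof. by apply/clsP/crelN; exact: repr_cls. Qed.

Fact qaddA : associative qadd.
Proof.
move=> u v w; case: (cls_surj u) (cls_surj v) (cls_surj w).
by move=> f -> [g ->] [h ->]; rewrite !qaddE addrA.
Qed.

Fact qaddC : commutative qadd.
Proof.
move=> u v; case: (cls_surj u) (cls_surj v).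
by move=> f -> [g ->]; rewrite !qaddE addrC.
Qed.

Fact qadd0 : left_id (cls 0) qadd.
Proof. by move=> u; case: (cls_surj u) => f ->; rewrite qaddE add0r. Qed.

Fact qaddN : left_inverse (cls 0) qopp qadd.
Proof. by move=> u; case: (cls_surj u) => f ->; rewrite qoppE qaddE addNr. Qed.

HB.instance Definition _ := GRing.isZmodule.Build qhom qaddA qaddC qadd0 qaddN.

Lemma clsD (f g : Hom X Y) : cls (f + g) = cls f + cls g.
Proof. by rewrite -qaddE. Qed.

Lemma clsN (f : Hom X Y) : cls (- f) = - cls f.
Proof. by rewrite -qoppE. Qed.

Lemma cls0 : cls 0 = 0 :> qhom. Proof. by []. Qed.

End Hom.

Definition qcomp (X Y Z : C) (v : qhom Y Z) (u : qhom X Y) : qhom X Z :=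
  cls (repr v ∘ repr u).

Lemma qcompE (X Y Z : C) (g : Hom Y Z) (f : Hom X Y) :
  qcomp (cls g) (cls f) = cls (g ∘ f).
Proof. by apply/clsP/crel_comp; exact: repr_cls. Qed.

Definition quotient_category : additive_category.
Proof.
apply: (@AdditiveCategory C (fun X Y => GRing.Zmodule.clone (qhom X Y) _)
  (fun X => cls (idm X)) qcomp _ _ _ _ _ zob _ _ bip
  (fun A B => cls inj1) (fun A B => cls inj2)
  (fun A B => cls prj1) (fun A B => cls prj2)).
- move=> A B D E u v w; case: (cls_surj u) (cls_surj v) (cls_surj w).
  by move=> f -> [g ->] [h ->]; rewrite !qcompE mcompA.
- by move=> A B u; case: (cls_surj u) => f ->; rewrite qcompE comp_idl.
- by move=> A B u; case: (cls_surj u) => f ->; rewrite qcompE comp_idr.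
- move=> A B D u v w; case: (cls_surj u) (cls_surj v) (cls_surj w).
  by move=> f -> [g ->] [h ->]; rewrite -clsD !qcompE -clsD mcompDl.
- move=> A B D u v w; case: (cls_surj u) (cls_surj v) (cls_surj w).
  by move=> f -> [g ->] [h ->]; rewrite -clsD !qcompE -clsD mcompDr.
- by move=> A u; case: (cls_surj u) => f ->; rewrite (zob_initial f) cls0.
- by move=> A u; case: (cls_surj u) => f ->; rewrite (zob_terminal f) cls0.
- by move=> A B; rewrite qcompE prj1_inj1.
- by move=> A B; rewrite qcompE prj2_inj2.
- by move=> A B; rewrite qcompE prj1_inj2 cls0.
- by move=> A B; rewrite qcompE prj2_inj1 cls0.
- by move=> A B; rewrite !qcompE -clsD bip_id.
Defined.

Variables (F : additive_functor C C)
  (FR : forall X Y (f g : Hom X Y), crel R f g -> crel R (fmap F f) (fmap F g)).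

Definition qfmap (X Y : C) (u : qhom X Y) : qhom (F X) (F Y) :=
  cls (fmap F (repr u)).

Lemma qfmapE (X Y : C) (f : Hom X Y) : qfmap (cls f) = cls (fmap F f).
Proof. by apply/clsP/FR; exact: repr_cls. Qed.

Definition quotient_functor :
  additive_functor quotient_category quotient_category.
Proof.
apply: (@AdditiveFunctor quotient_category quotient_category F qfmap).
- by move=> A; rewrite qfmapE fmap_id.
- move=> A B D u v; case: (cls_surj u) (cls_surj v) => f -> [g ->].
  by rewrite /= qcompE !qfmapE fmap_comp qcompE.
- move=> A B u v; case: (cls_surj u) (cls_surj v) => f -> [g ->].
  by rewrite /= -clsD !qfmapE fmapD clsD.
Defined.

End Quotient.

Section Families.
Variables (C : additive_category) (n : nat).

Definition fam_hom (X Y : 'I_n -> C) := forall j, Hom (X j) (Y j).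

HB.instance Definition _ X Y := gen_eqMixin (fam_hom X Y).
HB.instance Definition _ X Y := gen_choiceMixin (fam_hom X Y).

Section Zmodule.
Variables X Y : 'I_n -> C.

Definition fam_add (f g : fam_hom X Y) : fam_hom X Y := fun j => f j + g j.
Definition fam_opp (f : fam_hom X Y) : fam_hom X Y := fun j => - f j.
Definition fam_zero : fam_hom X Y := fun j => 0.

Fact fam_addA : associative fam_add.
Proof. by move=> f g h; apply: functional_extensionality_dep => j; exact: addrA. Qed.
Fact fam_addC : commutative fam_add.
Proof. by move=> f g; apply: functional_extensionality_dep => j; exact: addrC. Qed.
Fact fam_add0 : left_id fam_zero fam_add.
Proof. by move=> f; apply: functional_extensionality_dep => j; exact: add0r. Qed.
Fact fam_addN : left_inverse fam_zero fam_opp fam_add.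
Proof. by move=> f; apply: functional_extensionality_dep => j; exact: addNr. Qed.

HB.instance Definition _ :=
  GRing.isZmodule.Build (fam_hom X Y) fam_addA fam_addC fam_add0 fam_addN.

End Zmodule.

Definition power_category : additive_category.
Proof.
apply: (@AdditiveCategory ('I_n -> C) (fun X Y => GRing.Zmodule.clone (fam_hom X Y) _)
  (fun X j => idm (X j)) (fun X Y Z g f j => g j ∘ f j) _ _ _ _ _
  (fun _ => zob) _ _ (fun X Y j => bip (X j) (Y j))
  (fun X Y j => inj1) (fun X Y j => inj2)
  (fun X Y j => prj1) (fun X Y j => prj2));
  move=> *; apply: functional_extensionality_dep => j.
- exact: mcompA.
- exact: comp_idl.
- exact: comp_idr.
- exact: mcompDl.
- exact: mcompDr.
- exact: zob_initial.
- exact: zob_terminal.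
- exact: prj1_inj1.
- exact: prj2_inj2.
- exact: prj1_inj2.
- exact: prj2_inj1.
- exact: bip_id.
Defined.

End Families.

Definition cast_cod (C : additive_category) (A B B' : C) (e : B = B')
    (f : Hom A B) : Hom A B' := eq_rect B (fun Z => Hom A Z) f B' e.

Section Cast.
Variable C : additive_category.

Lemma cast_irr (A B B' : C) (e e' : B = B') (f : Hom A B) :
  cast_cod e f = cast_cod e' f.
Proof. by rewrite (Prop_irrelevance e e'). Qed.

Lemma cast_trans (A B B' B'' : C) (e : B = B') (e' : B' = B'') (f : Hom A B) :
  cast_cod e' (cast_cod e f) = cast_cod (etrans e e') f.
Proof. by case: _ / e'; case: _ / e. Qed.

Lemma cast_comp (A A' B B' : C) (e : B = B') (g : Hom A' B) (f : Hom A A') :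
  cast_cod e (g ∘ f) = cast_cod e g ∘ f.
Proof. by case: _ / e. Qed.

Lemma cast_fmap (D : additive_category) (F : additive_functor C D)
  (A B B' : C) (e : B = B') (f : Hom A B) :
  fmap F (cast_cod e f) = cast_cod (f_equal F e) (fmap F f).
Proof. by case: _ / e. Qed.

Lemma cast_fam (n : nat) (X Y Y' : power_category C n) (e : Y = Y')
  (f : Hom X Y) (j : 'I_n) (e' : Y j = Y' j) :
  cast_cod e f j = cast_cod e' (f j).
Proof. by case: _ / e e' => e'; rewrite (cast_irr e' erefl). Qed.

End Cast.

Section Iterate.
Variables (C : additive_category) (S : additive_functor C C).

Fixpoint fiter (k : nat) (X Y : C) (f : Hom X Y) :
    Hom (iter k S X) (iter k S Y) :=
  if k is k'.+1 then fmap S (fiter k' f) else f.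

(* By functoriality, [ncomp d k] is S^(k-1)(d) ∘ ... ∘ S(d) ∘ d. *)
Fixpoint ncomp (X : C) (d : Hom X (S X)) (k : nat) : Hom X (iter k S X) :=
  if k is k'.+1 then fmap S (ncomp d k') ∘ d else idm X.

Lemma ncomp_nat (X Y : C) (dX : Hom X (S X)) (dY : Hom Y (S Y)) (f : Hom X Y) k :
  fmap S f ∘ dX = dY ∘ f -> fiter k f ∘ ncomp dX k = ncomp dY k ∘ f.
Proof.
move=> fP; elim: k => [|k IH] /=; first by rewrite comp_idl comp_idr.
by rewrite mcompA -fmap_comp IH fmap_comp -mcompA fP mcompA.
Qed.

Lemma ncompN (X : C) (d : Hom X (S X)) k :
  ncomp (- d) k = if odd k then - ncomp d k else ncomp d k.
Proof.
elim: k => [//|k /= ->]; case: (odd k) => /=.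
  by rewrite fmapN compNm compmN opprK.
by rewrite compmN.
Qed.

Lemma ncomp_fmap (X : C) (d : Hom X (S X)) k :
  exists e : iter k S (S X) = S (iter k S X),
    cast_cod e (ncomp (fmap S d) k) = fmap S (ncomp d k).
Proof.
elim: k => [|k [e eP]] /=; first by exists erefl; rewrite /= fmap_id.
exists (f_equal S e).
by rewrite fmap_comp cast_comp -cast_fmap eP.
Qed.

(* The differential of a mapping cone; [fmap S inj1] and [fmap S inj2]
   identify S(S X) ⊕ S Y with S(S X ⊕ Y). *)
Definition cone_diff (X Y : C) (dX : Hom X (S X)) (dY : Hom Y (S Y))
    (f : Hom X Y) : Hom (bip (S X) Y) (S (bip (S X) Y)) :=
  fmap S inj1 ∘ (- fmap S dX) ∘ prj1
  + fmap S inj2 ∘ (fmap S f ∘ prj1 + dY ∘ prj2).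

Section Cone.
Variables (X Y : C) (dX : Hom X (S X)) (dY : Hom Y (S Y)) (f : Hom X Y).

Lemma cone_diff_inj1 :
  cone_diff dX dY f ∘ inj1
  = fmap S inj1 ∘ (- fmap S dX) + fmap S inj2 ∘ fmap S f.
Proof.
rewrite /cone_diff mcompDl -!mcompA prj1_inj1 comp_idr; congr (_ + _ ∘ _).
by rewrite mcompDl -!mcompA prj1_inj1 prj2_inj1 compm0 comp_idr addr0.
Qed.

Lemma cone_diff_inj2 : fmap S inj2 ∘ dY = cone_diff dX dY f ∘ inj2.
Proof.
rewrite /cone_diff mcompDl -!mcompA prj1_inj2 !compm0 add0r; congr (_ ∘ _).
by rewrite mcompDl -!mcompA prj1_inj2 prj2_inj2 compm0 comp_idr add0r.
Qed.

Lemma cone_diff_prj1 :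
  fmap S prj1 ∘ cone_diff dX dY f = (- fmap S dX) ∘ prj1.
Proof.
rewrite /cone_diff mcompDr !mcompA -!fmap_comp prj1_inj1 prj1_inj2.
by rewrite fmap_id fmap0 comp0m comp_idl addr0.
Qed.

Hypothesis fP : fmap S f ∘ dX = dY ∘ f.

Lemma ncomp_cone k : ~~ odd k ->
  ncomp (cone_diff dX dY f) k ∘ inj1
  = fiter k inj1 ∘ ncomp (- fmap S dX) k.
Proof.
rewrite -[k]odd_double_half => /[dup]; rewrite oddD odd_double addbF oddb.
move=> /negPf -> _; rewrite add0n; elim: (k./2) => [|m IH].
  by rewrite /= comp_idl comp_idr.
rewrite doubleS; set D := cone_diff dX dY f; set d' := - fmap S dX.
have odd_step : ncomp D (m.*2).+1 ∘ inj1
    = fiter (m.*2).+1 inj1 ∘ ncomp d' (m.*2).+1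
      + fiter (m.*2).+1 inj2 ∘ fmap S (fiter m.*2 f ∘ ncomp dX m.*2).
  rewrite /= -mcompA cone_diff_inj1 -/d' mcompDr !mcompA -!fmap_comp IH.
  by rewrite -(ncomp_nat _ cone_diff_inj2) !fmap_comp -!mcompA -!fmap_comp
    (ncomp_nat _ fP).
rewrite [LHS]/= -[X in X = _]mcompA cone_diff_inj1 -/D -/d' mcompDr.
rewrite !mcompA -!fmap_comp -/(ncomp D (m.*2).+1) odd_step.
rewrite -(ncomp_nat (m.*2).+1 cone_diff_inj2) fmapD mcompDl -addrA.
set a := fiter m.*2 f ∘ ncomp dX m.*2; set i2 := fiter _ inj2.
have fa : ncomp dY (m.*2).+1 ∘ f = fmap S a ∘ dX.
  by rewrite -(ncomp_nat _ fP) /a fmap_comp -mcompA.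
by rewrite -mcompA fa /d' !compmN !fmap_comp -!mcompA addNr addr0.
Qed.

End Cone.
End Iterate.

Section Factorizations.
Variables (n : nat) (n_gt1 : (1 < n)%N).
Variables (A : additive_category) (T : additive_functor A A).
Variable omega : nat_trans (id_functor A) T.
Hypothesis omegaT : forall X : A, omega (T X) = fmap T (omega X).

Local Notation fam := (power_category A n).

Definition first : 'I_n := Ordinal (ltnW n_gt1).

(* [succ j] is [Some (j+1)] if j < n-1, and [None] if j = n-1. *)
Definition succ (j : 'I_n) : option 'I_n := insub j.+1.

Lemma succP (j : 'I_n) :
  if succ j is Some k then k = j.+1 :> nat else j.+1 = n.
Proof.
rewrite /succ; case: insubP => [k _ ->//|]; rewrite -leqNgt => le_nj.
by apply/eqP; rewrite eqn_leq le_nj ltn_ord.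
Qed.

Definition next_ob (X : fam) (o : option 'I_n) : A :=
  if o is Some k then X k else T (X first).

Definition next_hom (X Y : fam) (f : Hom X Y) (o : option 'I_n) :
    Hom (next_ob X o) (next_ob Y o) :=
  match o with Some k => f k | None => fmap T (f first) end.

Lemma next_hom_id (X : fam) o : next_hom (idm X) o = idm (next_ob X o).
Proof. by case: o => [k|] //=; rewrite fmap_id. Qed.

Lemma next_hom_comp (X Y Z : fam) (g : Hom Y Z) (f : Hom X Y) o :
  next_hom (g ∘ f) o = next_hom g o ∘ next_hom f o.
Proof. by case: o => [k|] //=; rewrite fmap_comp. Qed.

Lemma next_homD (X Y : fam) (f g : Hom X Y) o :
  next_hom (f + g) o = next_hom f o + next_hom g o.
Proof. by case: o => [k|] //=; rewrite fmapD. Qed.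

(* (X^0, ..., X^(n-1)) |-> (X^1, ..., X^(n-1), T(X^0)) *)
Definition shift : additive_functor fam fam :=
  @AdditiveFunctor fam fam
    (fun X j => next_ob X (succ j))
    (fun X Y f j => next_hom f (succ j))
    (fun X => functional_extensionality_dep (fun j => next_hom_id X (succ j)))
    (fun X Y Z g f =>
       functional_extensionality_dep (fun j => next_hom_comp g f (succ j)))
    (fun X Y f g =>
       functional_extensionality_dep (fun j => next_homD f g (succ j))).

Lemma iter_shift_lt k (j i : 'I_n) : i = (j + k)%N :> nat ->
  exists e : forall X : fam, iter k shift X j = X i,
    forall (X Y : fam) (f : Hom X Y) (Z : A) (h : Hom Z (iter k shift X j)),
      cast_cod (e Y) (fiter shift k f j ∘ h) = f i ∘ cast_cod (e X) h.
Proof.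
elim: k j => [|k IH] j.
  by rewrite addn0 => /val_inj ->; exists (fun=> erefl).
rewrite addnS -addSn /= => ei.
move: (succP j); case: (succ j) => [j'|] /= ej'; first by apply: IH; rewrite ej'.
by have := ltn_ord i; rewrite ei ej' -ltn_subRL subnn.
Qed.

Lemma iter_shift_ge k (j i : 'I_n) : (n + i = j + k)%N ->
  exists e : forall X : fam, iter k shift X j = T (X i),
    forall (X Y : fam) (f : Hom X Y) (Z : A) (h : Hom Z (iter k shift X j)),
      cast_cod (e Y) (fiter shift k f j ∘ h) = fmap T (f i) ∘ cast_cod (e X) h.
Proof.
elim: k j => [|k IH] j.
  rewrite addn0 => ej; have := ltn_ord j.
  by rewrite -ej -ltn_subRL subnn.
rewrite addnS -addSn /= => ei.
move: (succP j); case: (succ j) => [j'|] /= ej'; first by apply: IH; rewrite ej'.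
have [e eP] : exists e : forall X : fam, iter k shift X first = X i,
    forall (X Y : fam) (f : Hom X Y) (Z : A) (h : Hom Z (iter k shift X first)),
      cast_cod (e Y) (fiter shift k f first ∘ h) = f i ∘ cast_cod (e X) h.
  by apply: iter_shift_lt => /=; apply/(@addnI n); rewrite ei ej'.
exists (fun X => f_equal T (e X)) => X Y f Z h.
rewrite cast_comp -cast_fmap.
have -> : cast_cod (e Y) (fiter shift k f first) = f i ∘ cast_cod (e X) (idm _).
  by rewrite -eP comp_idr.
by rewrite fmap_comp -mcompA cast_fmap -cast_comp fmap_id comp_idl.
Qed.

Lemma iter_shift (X : fam) (j : 'I_n) : iter n shift X j = T (X j).
Proof. by have [e _] := @iter_shift_ge n j j (addnC _ _); exact: e. Qed.

Lemma cast_shift (X Y : fam) (f : Hom X Y) (j : 'I_n) (Z : A)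
    (h : Hom Z (iter n shift X j)) :
  cast_cod (iter_shift Y j) (fiter shift n f j ∘ h)
  = fmap T (f j) ∘ cast_cod (iter_shift X j) h.
Proof.
have [e eP] := @iter_shift_ge n j j (addnC _ _).
by rewrite (cast_irr _ (e Y)) (cast_irr _ (e X)) eP.
Qed.

(* [ncomp d n j] is the n-fold composition
     T(d^(j-1)) ∘ ... ∘ T(d^0) ∘ d^(n-1) ∘ ... ∘ d^j;
   its codomain is T(X^j) only up to the provable equality [iter_shift], and by
   proof irrelevance the choice of that equality is immaterial. *)
Definition factors (X : fam) (d : Hom X (shift X)) : Prop :=
  forall j : 'I_n, cast_cod (iter_shift X j) (ncomp d n j) = omega (X j).

(* [diff j] goes from X^j to X^(j+1) if j < n-1, and from X^(n-1) to T(X^0). *)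
Record factorization := Factorization {
  obj : fam;
  diff : Hom obj (shift obj);
  diffP : factors diff
}.

Record fact_hom (X Y : factorization) := FactHom {
  mor : Hom (obj X) (obj Y);
  morP : fmap shift mor ∘ diff X = diff Y ∘ mor
}.

Lemma mor_inj (X Y : factorization) : injective (@mor X Y).
Proof.
by move=> [f fP] [g gP] /= e; case: _ / e gP => gP; rewrite (Prop_irrelevance fP gP).
Qed.

HB.instance Definition _ X Y := gen_eqMixin (fact_hom X Y).
HB.instance Definition _ X Y := gen_choiceMixin (fact_hom X Y).

Section Zmodule.
Variables X Y : factorization.

Fact fact_add_proof (f g : fact_hom X Y) :
  fmap shift (mor f + mor g) ∘ diff X = diff Y ∘ (mor f + mor g).
Proof. by rewrite fmapD mcompDl mcompDr !morP. Qed.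

Fact fact_opp_proof (f : fact_hom X Y) :
  fmap shift (- mor f) ∘ diff X = diff Y ∘ (- mor f).
Proof. by rewrite fmapN compNm compmN morP. Qed.

Fact fact_zero_proof :
  fmap shift (0 : Hom (obj X) (obj Y)) ∘ diff X = diff Y ∘ 0.
Proof. by rewrite fmap0 comp0m compm0. Qed.

Definition fact_add f g := FactHom (fact_add_proof f g).
Definition fact_opp f := FactHom (fact_opp_proof f).
Definition fact_zero := FactHom fact_zero_proof.

Fact fact_addA : associative fact_add.
Proof. by move=> f g h; apply: mor_inj; exact: addrA. Qed.
Fact fact_addC : commutative fact_add.
Proof. by move=> f g; apply: mor_inj; exact: addrC. Qed.
Fact fact_add0 : left_id fact_zero fact_add.
Proof. by move=> f; apply: mor_inj; exact: add0r. Qed.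
Fact fact_addN : left_inverse fact_zero fact_opp fact_add.
Proof. by move=> f; apply: mor_inj; exact: addNr. Qed.

HB.instance Definition _ := GRing.isZmodule.Build (fact_hom X Y)
  fact_addA fact_addC fact_add0 fact_addN.

End Zmodule.

Fact fact_id_proof (X : factorization) :
  fmap shift (idm (obj X)) ∘ diff X = diff X ∘ idm (obj X).
Proof. by rewrite fmap_id comp_idl comp_idr. Qed.

Definition fact_id (X : factorization) : fact_hom X X :=
  FactHom (fact_id_proof X).

Fact fact_comp_proof (X Y Z : factorization) (g : fact_hom Y Z)
  (f : fact_hom X Y) :
  fmap shift (mor g ∘ mor f) ∘ diff X = diff Z ∘ (mor g ∘ mor f).
Proof. by rewrite fmap_comp -mcompA morP mcompA morP mcompA. Qed.

Definition fact_comp (X Y Z : factorization) (g : fact_hom Y Z)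
  (f : fact_hom X Y) : fact_hom X Z := FactHom (fact_comp_proof g f).

Fact zero_diffP : factors (0 : Hom (zob : fam) (shift zob)).
Proof. by move=> j; rewrite [RHS]zob_initial; exact: zob_initial. Qed.

Definition fact_zob : factorization := Factorization zero_diffP.

Lemma factors_comp (Z : factorization) (W : fam) (d : Hom W (shift W))
    (u : Hom (obj Z) W) : fmap shift u ∘ diff Z = d ∘ u ->
  forall j, cast_cod (iter_shift W j) (ncomp d n j) ∘ u j = omega (W j) ∘ u j.
Proof.
move=> uP j; rewrite -cast_comp.
have -> : ncomp d n j ∘ u j = fiter shift n u j ∘ ncomp (diff Z) n j.
  have e := esym (ncomp_nat n uP).
  exact: (congr1 (fun h : Hom (obj Z) (iter n shift W) => h j) e).
by rewrite cast_shift diffP -(naturality omega).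
Qed.

Section Biproduct.
Variables X Y : factorization.

Definition bip_diff : Hom (bip (obj X) (obj Y)) (shift (bip (obj X) (obj Y))) :=
  fmap shift inj1 ∘ diff X ∘ prj1 + fmap shift inj2 ∘ diff Y ∘ prj2.

Fact bip_inj1P : fmap shift inj1 ∘ diff X = bip_diff ∘ inj1.
Proof.
by rewrite mcompDl -!mcompA prj1_inj1 prj2_inj1 !compm0 comp_idr addr0.
Qed.

Fact bip_inj2P : fmap shift inj2 ∘ diff Y = bip_diff ∘ inj2.
Proof.
by rewrite mcompDl -!mcompA prj1_inj2 prj2_inj2 !compm0 comp_idr add0r.
Qed.

Fact bip_prj1P : fmap shift prj1 ∘ bip_diff = diff X ∘ prj1.
Proof.
rewrite mcompDr !mcompA -!fmap_comp prj1_inj1 prj1_inj2.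
by rewrite fmap_id fmap0 !comp0m comp_idl addr0.
Qed.

Fact bip_prj2P : fmap shift prj2 ∘ bip_diff = diff Y ∘ prj2.
Proof.
rewrite mcompDr !mcompA -!fmap_comp prj2_inj1 prj2_inj2.
by rewrite fmap_id fmap0 !comp0m comp_idl add0r.
Qed.

Fact bip_diffP : factors bip_diff.
Proof.
by move=> j; apply: bip_ext; [exact: (factors_comp bip_inj1P)
  | exact: (factors_comp bip_inj2P)].
Qed.

Definition fact_bip : factorization := Factorization bip_diffP.

End Biproduct.

Definition Fact : additive_category.
Proof.
apply: (@AdditiveCategory factorization
  (fun X Y => GRing.Zmodule.clone (fact_hom X Y) _)
  fact_id fact_comp _ _ _ _ _ fact_zob _ _ fact_bip
  (fun X Y => @FactHom X (fact_bip X Y) inj1 (bip_inj1P X Y))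
  (fun X Y => @FactHom Y (fact_bip X Y) inj2 (bip_inj2P X Y))
  (fun X Y => @FactHom (fact_bip X Y) X prj1 (bip_prj1P X Y))
  (fun X Y => @FactHom (fact_bip X Y) Y prj2 (bip_prj2P X Y)));
  move=> *; apply: mor_inj.
- exact: mcompA.
- exact: comp_idl.
- exact: comp_idr.
- exact: mcompDl.
- exact: mcompDr.
- exact: zob_initial.
- exact: zob_terminal.
- exact: prj1_inj1.
- exact: prj2_inj2.
- exact: prj1_inj2.
- exact: prj2_inj1.
- exact: bip_id.
Defined.

(* s consists of s^j : X^(j+1) -> Y^j for j < n-1 and s^(n-1) : T(X^0) -> Y^(n-1).
   The component of the equation at j < n-1 is
     f^(j+1) - g^(j+1) = d_Y^j s^j + s^(j+1) d_X^(j+1),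
   and the one at n-1 is
     T(f^0 - g^0) = d_Y^(n-1) s^(n-1) + T(s^0 d_X^0). *)
Definition homotopic (X Y : Fact) (f g : Hom X Y) : Prop :=
  exists s : Hom (shift (obj X)) (obj Y),
    fmap shift (mor f - mor g) = diff Y ∘ s + fmap shift (s ∘ diff X).

Definition homotopy_congruence : congruence Fact.
Proof.
apply: (@Congruence Fact homotopic).
- move=> X Y f; exists 0.
  by rewrite subrr compm0 comp0m !fmap0 addr0.
- move=> X Y f g [s sP]; exists (- s).
  by rewrite -opprB fmapN sP compmN compNm fmapN opprD.
- move=> X Y f g h [s sP] [t tP]; exists (s + t).
  rewrite -[mor f](subrK (mor g)) -addrA fmapD sP tP.
  by rewrite mcompDr mcompDl fmapD addrACA.
- move=> X Y f f' g g' [s sP] [t tP]; exists (s + t).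
  rewrite [X in fmap _ X](_ : _ = (mor f - mor f') + (mor g - mor g')).
    by rewrite fmapD sP tP mcompDr mcompDl fmapD addrACA.
  by rewrite [mor (f + g)]/= [mor (f' + g')]/= opprD addrACA.
- move=> X Y Z g g' f f' [t tP] [s sP].
  exists (t ∘ fmap shift (mor f) + mor g' ∘ s).
  rewrite [X in fmap _ X](_ : _ =
      (mor g - mor g') ∘ mor f + mor g' ∘ (mor f - mor f')); last first.
    rewrite mcompDl mcompDr compNm compmN addrA subrK.
    by rewrite [mor (g ∘ f)]/= [mor (g' ∘ f')]/=.
  rewrite fmapD !fmap_comp tP sP !mcompDl !mcompDr !mcompA -morP.
  rewrite addrACA; congr (_ + _).
  by rewrite -!fmap_comp -fmapD mcompDl -!mcompA morP.
Defined.

Definition HFact : additive_category := quotient_category homotopy_congruence.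

Definition hclass (X Y : Fact) (f : Hom X Y) : @Hom HFact X Y :=
  cls homotopy_congruence f.

Hypothesis n_even : ~~ odd n.

Section Suspension.

Fact susp_diffP (X : Fact) : factors (- fmap shift (diff X)).
Proof.
move=> j; rewrite ncompN (negPf n_even).
have [e eP] := ncomp_fmap (diff X) n.
have ej : iter n shift (shift (obj X)) j = shift (iter n shift (obj X)) j.
  by rewrite e.
have ej' : shift (iter n shift (obj X)) j = T (shift (obj X) j).
  by rewrite -ej iter_shift.
rewrite (cast_irr _ (etrans ej ej')) -cast_trans -(cast_fam e) eP.
move: ej' => /= ; case: (succ j) => [k|] /= e'.
  by rewrite (cast_irr _ (iter_shift _ k)) diffP.
rewrite (cast_irr _ (f_equal T (iter_shift _ first))) -cast_fmap diffP.
exact/esym/omegaT.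
Qed.

Definition susp_obj (X : Fact) : Fact := Factorization (susp_diffP X).

Fact susp_morP (X Y : Fact) (f : Hom X Y) :
  fmap shift (fmap shift (mor f)) ∘ diff (susp_obj X)
  = diff (susp_obj Y) ∘ fmap shift (mor f).
Proof. by rewrite compmN compNm -!fmap_comp morP. Qed.

Definition susp_mor (X Y : Fact) (f : Hom X Y) :
  Hom (susp_obj X) (susp_obj Y) :=
  @FactHom (susp_obj X) (susp_obj Y) (fmap shift (mor f)) (susp_morP f).

Definition fact_suspension : additive_functor Fact Fact.
Proof.
apply: (@AdditiveFunctor Fact Fact susp_obj susp_mor).
- by move=> X; apply: mor_inj; exact: fmap_id.
- by move=> X Y Z g f; apply: mor_inj; exact: fmap_comp.
- by move=> X Y f g; apply: mor_inj; exact: fmapD.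
Defined.

Lemma suspension_homotopic (X Y : Fact) (f g : Hom X Y) :
  crel homotopy_congruence f g ->
  crel homotopy_congruence (fmap fact_suspension f) (fmap fact_suspension g).
Proof.
move=> [s sP]; exists (- fmap shift s).
change (fmap shift (fmap shift (mor f) - fmap shift (mor g))
  = (- fmap shift (diff Y)) ∘ (- fmap shift s)
    + fmap shift ((- fmap shift s) ∘ (- fmap shift (diff X)))).
by rewrite !compNm !compmN !opprK -fmapN -fmapD sP fmapD !fmap_comp.
Qed.

Definition suspension : additive_functor HFact HFact :=
  quotient_functor suspension_homotopic.

End Suspension.

Section Cone.
Variables (X Y : Fact) (f : Hom X Y).

Fact cone_diffP : factors (cone_diff (diff X) (diff Y) (mor f)).
Proof.
move=> j; apply: bip_ext; last first.
  exact: (factors_comp (cone_diff_inj2 (diff X) (diff Y) (mor f))).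
rewrite -cast_comp.
have e := ncomp_cone (morP f) n_even.
have -> : ncomp (cone_diff (diff X) (diff Y) (mor f)) n j ∘ inj1
    = fiter shift n inj1 j ∘ ncomp (diff (susp_obj X)) n j.
  exact: (congr1 (fun h : Hom (shift (obj X)) (iter n shift _) => h j) e).
by rewrite cast_shift (diffP (susp_obj X) j) -(naturality omega).
Qed.

Definition cone : Fact := Factorization cone_diffP.

Definition cone_inj : Hom Y cone :=
  @FactHom Y cone inj2 (cone_diff_inj2 (diff X) (diff Y) (mor f)).

Definition cone_prj : Hom cone (fact_suspension X) :=
  @FactHom cone (susp_obj X) prj1 (cone_diff_prj1 (diff X) (diff Y) (mor f)).

Definition cone_sixtuple : sixtuple suspension :=
  @Sixtuple HFact suspension X Y cone
    (hclass f) (hclass cone_inj) (hclass cone_prj).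

End Cone.

Definition cone_triangles (t : sixtuple suspension) : Prop :=
  exists (X Y : Fact) (f : Hom X Y), sixtuple_iso t (cone_sixtuple f).

End Factorizations.

Arguments suspension {n} n_gt1 {A T omega} omegaT n_even.
Arguments cone_triangles {n} n_gt1 {A T omega} omegaT n_even t.

(* Main.v *)
From HB Require Import structures.
Require Import Defs.
From mathcomp Require Import all_boot.
From mathcomp Require Import ssralg.

(** Write S for the shift of families, so that a factorization is a family X
with a differential d : X -> S X.  The suspension (S X, - S d), the cone
S X (+) Y of f : X -> Y and the homotopies s : S X -> Y with
S (f - g) = d s + S (s d) only involve the additive functor S.  The condition
on n-fold composites is a property of objects; it is through it that the parity
of n and the equation between omega T and T omega matter, and it holds for all
suspensions and cones.  So the theorem is an instance of the classical fact that
mapping cones triangulate a homotopy category, where S need not be an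
equivalence: this is why triangles can only be rotated in one direction.

The proof has two independent halves.  The first one is formal
([standard_right_triangulated]): let nabla be the closure under isomorphism of
a class of standard triangles.  Besides the triangle of an identity, it is
enough that standard triangles can be rotated, that commutative squares between
them can be completed, that the third map of a standard triangle is a weak
cokernel of the second, and that every composable pair of morphisms has an
octahedron made of standard triangles.  The weak cokernel property makes the
third object of a triangle unique up to isomorphism (if c is an endomorphism of
a triangle which is the identity on the other two objects, then
(c - 1)^2 = 0), and this uniqueness transports octahedra from standard
triangles to arbitrary ones.

The second half supplies these facts for cones, by computing with matrices.  A
square b f ~ f' a commuting up to a homotopy s gives the morphism of cones
(x, y) |-> (S a x, s x + b y) ([cone_mapP]).  A morphism e = (e1, e2) out of a
cone with e2 ~ 0 through s is homotopic to (e1 - s S f) pi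
([cone_factor_homotopy]).  The other three facts compare a triangle X -> Y -> W
with the cone of X -> Y: W is zero and X -> Y an identity; W is the suspension
of X' and X -> Y is the inclusion of Y' into the cone of X' -> Y'; W is the
cone of g and X -> Y is the map from the cone of f to the cone of g f.  Each
time W is a deformation retract of the cone ([retract_cone_triangle]), and the
contracting homotopies have a common shape, which reduces their verification
to an equation without S ([cone_nullhomotopy]). *)

Set Implicit Arguments.
Unset Strict Implicit.
Unset Printing Implicit Defensive.

Import GRing.Theory.
Local Open Scope ring_scope.
Local Open Scope cat_scope.

(** * Matrices of morphisms and mapping cones *)

(** Locked, so that the distributivity rules below do not see the sum in a
row matrix: rows are only ever evaluated on the two injections. *)
HB.lock Definition copair (C : additive_category) (A B E : C) (u : Hom A E)
  (v : Hom B E) : Hom (bip A B) E := u ∘ prj1 + v ∘ prj2.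

Section MatrixCalculus.
Variable C : additive_category.

Lemma bipE (A B : C) :
  ((@prj1 C A B ∘ inj1 = idm A) *
   (forall W (x : Hom W A), @prj1 C A B ∘ (inj1 ∘ x) = x) *
   (@prj2 C A B ∘ inj2 = idm B) *
   (forall W (x : Hom W B), @prj2 C A B ∘ (inj2 ∘ x) = x) *
   (@prj1 C A B ∘ inj2 = 0) *
   (forall W (x : Hom W B), @prj1 C A B ∘ (inj2 ∘ x) = 0) *
   (@prj2 C A B ∘ inj1 = 0) *
   (forall W (x : Hom W A), @prj2 C A B ∘ (inj1 ∘ x) = 0))%type.
Proof.
by do !split=> *; rewrite ?mcompA (prj1_inj1, prj2_inj2, prj1_inj2, prj2_inj1)
  ?comp_idl ?comp0m.
Qed.

Lemma copairE (A B E : C) (u : Hom A E) (v : Hom B E) :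
  ((copair u v ∘ inj1 = u) *
   (forall W (x : Hom W A), copair u v ∘ (inj1 ∘ x) = u ∘ x) *
   (copair u v ∘ inj2 = v) *
   (forall W (x : Hom W B), copair u v ∘ (inj2 ∘ x) = v ∘ x))%type.
Proof.
have e1 : copair u v ∘ inj1 = u.
  by rewrite copair.unlock mcompDl -!mcompA !bipE compm0 comp_idr addr0.
have e2 : copair u v ∘ inj2 = v.
  by rewrite copair.unlock mcompDl -!mcompA !bipE compm0 comp_idr add0r.
by do !split=> *; rewrite ?mcompA ?(e1, e2).
Qed.

Lemma fmap_compA (D : additive_category) (F : additive_functor C D)
    (A B E : C) (W : D) (g : Hom B E) (f : Hom A B) (x : Hom W (F A)) :
  fmap F g ∘ (fmap F f ∘ x) = fmap F (g ∘ f) ∘ x.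
Proof. by rewrite fmap_comp mcompA. Qed.

Lemma fmap_bip_ext (D : additive_category) (F : additive_functor C D)
    (A B : C) (E : D) (f g : Hom (F (bip A B)) E) :
  f ∘ fmap F inj1 = g ∘ fmap F inj1 -> f ∘ fmap F inj2 = g ∘ fmap F inj2 ->
  f = g.
Proof.
move=> e1 e2; rewrite -[f]comp_idr -[g]comp_idr -!fmap_id -!bip_id !fmapD.
by rewrite !fmap_comp !mcompDr !mcompA e1 e2.
Qed.

(** The first column carries a single S because it is the value of S on
i2 f - i1 d: this is what makes composites with S of a map again values of S. *)
Lemma cone_diffE (S : additive_functor C C) (X Y : C)
    (dX : Hom X (S X)) (dY : Hom Y (S Y)) (f : Hom X Y) :
  cone_diff dX dY f
  = copair (fmap S (inj2 ∘ f - inj1 ∘ dX)) (fmap S inj2 ∘ dY).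
Proof.
apply: bip_ext; rewrite ?cone_diff_inj1 -?cone_diff_inj2 copairE //.
by rewrite fmapD fmapN !fmap_comp compmN addrC.
Qed.

End MatrixCalculus.

(** Normal form of a composite of matrices evaluated on injections: a sum of
right-associated words in which adjacent values of a functor are merged, so
that the relations between injections and projections apply inside them. *)
Ltac expand :=
  rewrite ?(fmapD, fmapN, fmap_id, =^~ fmap_comp, fmap_compA, mcompDl, mcompDr,
    compNm, compmN, =^~ mcompA, comp_idl, comp_idr, copairE, bipE);
  rewrite ?(fmap0, comp0m, compm0);
  rewrite ?(oppr0, opprD, opprK, addr0, add0r).

Section ConeCalculus.
Variables (C : additive_category) (S : additive_functor C C).

Section ConeMap.
Variables (X Y X' Y' : C).
Variables (dX : Hom X (S X)) (dY : Hom Y (S Y)).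
Variables (dX' : Hom X' (S X')) (dY' : Hom Y' (S Y')).
Variables (f : Hom X Y) (f' : Hom X' Y') (a : Hom X X') (b : Hom Y Y').
Variable s : Hom (S X) Y'.

Definition cone_map : Hom (bip (S X) Y) (bip (S X') Y') :=
  copair (inj1 ∘ fmap S a + inj2 ∘ s) (inj2 ∘ b).

(** The lower left entry s of the matrix makes up for the failure of the square
to commute: the mixed component of the equation is the homotopy relation. *)
Lemma cone_mapP :
  fmap S a ∘ dX = dX' ∘ a -> fmap S b ∘ dY = dY' ∘ b ->
  fmap S (b ∘ f - f' ∘ a) = dY' ∘ s + fmap S (s ∘ dX) ->
  fmap S cone_map ∘ cone_diff dX dY f = cone_diff dX' dY' f' ∘ cone_map.
Proof.
move=> aP bP sP; apply: bip_ext; rewrite /cone_map !cone_diffE; expand;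
  last first.
  by rewrite -(fmap_compA inj2 b) bP.
have eS : fmap S (inj2 ∘ (b ∘ f)) = fmap S (inj2 ∘ (f' ∘ a))
    + fmap S inj2 ∘ (dY' ∘ s) + fmap S (@inj2 _ (S X') Y' ∘ (s ∘ dX)).
  move: sP; rewrite fmapD fmapN => /(canRL (subrK _)) bf; rewrite fmap_comp bf.
  by expand; rewrite addrC addrA.
by rewrite aP eS (addrC (- _) (- _)) addrA addrK addrAC.
Qed.

Lemma cone_inj2_map : cone_map ∘ inj2 = inj2 ∘ b.
Proof. by rewrite /cone_map; expand. Qed.

Lemma cone_prj1_map : prj1 ∘ cone_map = fmap S a ∘ prj1.
Proof. by apply: bip_ext; rewrite /cone_map; expand. Qed.
End ConeMap.

(** For a homotopy of the form i1 (S v) the term d s of the homotopy relation is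
itself a value of S, because the first column of d is one.  Hence the relation
S h = d s + S (s d) follows from an equation without S, which can be checked on
the components of the source. *)
Lemma cone_nullhomotopy (X Y W : C) (dX : Hom X (S X)) (dY : Hom Y (S Y))
    (dW : Hom W (S W)) (f : Hom X Y) (v : Hom W X) (h : Hom W (bip (S X) Y)) :
  h = (inj2 ∘ f - inj1 ∘ dX) ∘ v + inj1 ∘ fmap S v ∘ dW ->
  fmap S h = cone_diff dX dY f ∘ (inj1 ∘ fmap S v)
             + fmap S (inj1 ∘ fmap S v ∘ dW).
Proof. by move=> ->; rewrite cone_diffE; expand. Qed.

(** The homotopy (x, y) |-> (y, 0) inverts the identity entry of the
differential. *)
Lemma cone_id_contractible (X : C) (dX : Hom X (S X)) :
  idm (bip (S X) X)
  = (inj2 ∘ idm X - inj1 ∘ dX) ∘ prj2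
    + inj1 ∘ fmap S prj2 ∘ cone_diff dX dX (idm X).
Proof. by apply: bip_ext; rewrite cone_diffE; expand; rewrite ?addrNK. Qed.

Section WeakCokernel.
Variables (X Y W : C).
Variables (dX : Hom X (S X)) (dY : Hom Y (S Y)) (dW : Hom W (S W)).
Variables (f : Hom X Y) (e : Hom (bip (S X) Y) W) (s : Hom (S Y) W).
Let d := cone_diff dX dY f.
Hypothesis eP : fmap S e ∘ d = dW ∘ e.
Hypothesis sP : fmap S (e ∘ inj2) = dW ∘ s + fmap S (s ∘ dY).

(** The restriction of e to S X is not compatible with the differentials; the
defect is S (e i2) (S f), which the homotopy s turns into a correction term. *)
Definition cone_factor : Hom (S X) W := e ∘ inj1 - s ∘ fmap S f.

Lemma fmap_null_inj2 V (v : Hom V Y) :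
  fmap S (e ∘ (inj2 ∘ v)) = dW ∘ (s ∘ fmap S v) + fmap S (s ∘ (dY ∘ v)).
Proof. by rewrite mcompA fmap_comp sP; expand. Qed.

Lemma cone_factorP : fmap S f ∘ dX = dY ∘ f ->
  fmap S cone_factor ∘ (- fmap S dX) = dW ∘ cone_factor.
Proof.
move=> fP; have := congr1 (fun h => h ∘ inj1) eP.
rewrite /d cone_diffE /cone_factor; expand => <-.
by rewrite fP fmap_null_inj2 (addrC (dW ∘ _)) addrAC addrK addrC.
Qed.

Lemma cone_factor_homotopy :
  fmap S (e - cone_factor ∘ prj1)
  = dW ∘ (s ∘ fmap S prj2) + fmap S (s ∘ fmap S prj2 ∘ d).
Proof.
rewrite -[e in LHS]comp_idr -bip_id /cone_factor /d /cone_diff; expand.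
by rewrite fmap_null_inj2 addrACA subrr add0r -addrA (addrC (fmap S _)).
Qed.
End WeakCokernel.

(** The cone of i : Y -> C_f is S Y (+) S X (+) Y, where the summands S Y and Y
cancel up to homotopy and leave S X. *)
Section Rotation.
Variables (X Y : C) (dX : Hom X (S X)) (dY : Hom Y (S Y)) (f : Hom X Y).
Let d := cone_diff dY (cone_diff dX dY f) inj2.

(** The component - S f is forced: in the differential of the cone of i both S X
and S Y map to S Y, by S f and by the identity, and the two must cancel. *)
Definition rot_in : Hom (S X) (bip (S Y) (bip (S X) Y)) :=
  inj2 ∘ inj1 - inj1 ∘ fmap S f.

Definition rot_out : Hom (bip (S Y) (bip (S X) Y)) (S X) := prj1 ∘ prj2.

Lemma rot_inP : fmap S f ∘ dX = dY ∘ f ->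
  fmap S rot_in ∘ (- fmap S dX) = d ∘ rot_in.
Proof.
move=> fP; rewrite /rot_in /d !cone_diffE; expand.
by rewrite fP addrACA subrr add0r.
Qed.

Lemma rot_outP : fmap S rot_out ∘ d = (- fmap S dX) ∘ rot_out.
Proof.
by apply: bip_ext; [|apply: bip_ext]; rewrite /rot_out /d
  !cone_diffE; expand.
Qed.

Lemma rot_outK : rot_out ∘ rot_in = idm (S X).
Proof. by rewrite /rot_out /rot_in; expand. Qed.

Lemma rot_out_inj2 : rot_out ∘ inj2 = prj1.
Proof. by rewrite /rot_out; expand. Qed.

Lemma prj1_rot_in : prj1 ∘ rot_in = - fmap S f.
Proof. by rewrite /rot_in; expand. Qed.

(** The homotopy (u, x, y) |-> (y, 0, 0) inverts the identity entry from the
summand S Y to the summand Y. *)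
Lemma rot_inK_homotopy :
  idm _ - rot_in ∘ rot_out
  = (inj2 ∘ inj2 - inj1 ∘ dY) ∘ (prj2 ∘ prj2)
    + inj1 ∘ fmap S (prj2 ∘ prj2) ∘ d.
Proof.
apply: bip_ext; [|apply: bip_ext];
  rewrite /rot_out /rot_in /d !cone_diffE; expand=> //.
- by rewrite addNKr.
- by rewrite subrK.
Qed.

End Rotation.

(** The cone of C_f -> C_(g f) is S S X (+) S Y (+) S X (+) Z, where the summands
S S X and S X cancel up to homotopy and leave S Y (+) Z = C_g. *)
Section Octahedron.
Variables (X Y Z : C).
Variables (dX : Hom X (S X)) (dY : Hom Y (S Y)) (dZ : Hom Z (S Z)).
Variables (f : Hom X Y) (g : Hom Y Z).
Let df := cone_diff dX dY f.
Let dg := cone_diff dY dZ g.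
Let dgf := cone_diff dX dZ (g ∘ f).
Let gamma := cone_map (idm X) g 0.
Let d := cone_diff df dgf gamma.

Definition oct_in : Hom (bip (S Y) Z) (bip (S (bip (S X) Y)) (bip (S X) Z)) :=
  copair (inj1 ∘ fmap S inj2) (inj2 ∘ inj2).

Definition oct_out : Hom (bip (S (bip (S X) Y)) (bip (S X) Z)) (bip (S Y) Z) :=
  copair (inj1 ∘ fmap S prj2) (cone_map f (idm Z) 0).

Lemma oct_inP : fmap S oct_in ∘ dg = d ∘ oct_in.
Proof.
by apply: bip_ext; rewrite /oct_in /d /dg /dgf /df !cone_diffE /gamma /cone_map;
  expand.
Qed.

Lemma oct_outP : fmap S f ∘ dX = dY ∘ f -> fmap S oct_out ∘ d = dg ∘ oct_out.
Proof.
move=> fP; apply: bip_ext; [apply: fmap_bip_ext | apply: bip_ext];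
  rewrite /oct_out /d /dg /dgf /df !cone_diffE /gamma /cone_map; expand=> //.
- by rewrite subrr.
- by rewrite fP.
Qed.

Lemma oct_outK : oct_out ∘ oct_in = idm _.
Proof. by apply: bip_ext; rewrite /oct_out /oct_in /cone_map; expand. Qed.

Lemma oct_out_inj2 : oct_out ∘ inj2 = cone_map f (idm Z) 0.
Proof. by rewrite /oct_out; expand. Qed.

Lemma prj1_oct_in : prj1 ∘ oct_in = fmap S inj2 ∘ prj1.
Proof. by apply: bip_ext; rewrite /oct_in; expand. Qed.

(** The homotopy (u, v, x, z) |-> (x, 0, 0, 0) inverts the identity entry from
the summand S S X to the summand S X. *)
Lemma oct_inK_homotopy :
  idm _ - oct_in ∘ oct_out
  = (inj2 ∘ gamma - inj1 ∘ df) ∘ (inj1 ∘ prj1 ∘ prj2)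
    + inj1 ∘ fmap S (inj1 ∘ prj1 ∘ prj2) ∘ d.
Proof.
apply: bip_ext; [apply: fmap_bip_ext | apply: bip_ext];
  rewrite /oct_out /oct_in /d /gamma /dgf /df !cone_diffE /cone_map;
  expand; rewrite ?subrr //.
by rewrite addrA addrK.
Qed.
End Octahedron.
End ConeCalculus.

(** * Isomorphisms and sixtuples *)

Section Isomorphisms.
Variable C : additive_category.

Lemma is_iso_id (A : C) : is_iso (idm A).
Proof. by exists (idm A); rewrite comp_idl. Qed.

Lemma is_iso_comp (A B E : C) (g : Hom B E) (f : Hom A B) :
  is_iso g -> is_iso f -> is_iso (g ∘ f).
Proof.
move=> [g' [g'K gK]] [f' [f'K fK]]; exists (f' ∘ g'); split.
  by rewrite mcompA -(mcompA f') g'K comp_idr.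
by rewrite mcompA -(mcompA g) fK comp_idr.
Qed.

Lemma is_iso_of_retractions (A B : C) (f : Hom A B) (g : Hom B A) :
  is_iso (g ∘ f) -> is_iso (f ∘ g) -> is_iso f.
Proof.
move=> [u [uP _]] [v [_ vP]]; exists (u ∘ g); split; first by rewrite -mcompA.
have <- : g ∘ v = u ∘ g.
  by rewrite -[LHS]comp_idl -uP -!mcompA [f ∘ _]mcompA vP comp_idr.
by rewrite mcompA.
Qed.

Lemma is_iso_fmap (D : additive_category) (F : additive_functor C D) (A B : C)
  (f : Hom A B) : is_iso f -> is_iso (fmap F f).
Proof.
by move=> [g [gK Kg]]; exists (fmap F g); rewrite -!fmap_comp gK Kg !fmap_id.
Qed.

(** (1 + e) (1 - e) = 1 - e e. *)
Lemma is_iso_square0 (A : C) (e : Hom A A) :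
  e ∘ e = 0 -> is_iso (idm A + e).
Proof.
move=> e2; exists (idm A - e); split.
  by rewrite mcompDl !mcompDr !compNm e2 !comp_idl comp_idr oppr0 addr0 addrK.
by rewrite mcompDl !mcompDr !compmN e2 !comp_idl comp_idr oppr0 addr0 subrK.
Qed.

End Isomorphisms.

Section Sixtuples.
Variables (C : additive_category) (Sigma : additive_functor C C).

Lemma sixtuple_iso_refl (t : sixtuple Sigma) : sixtuple_iso t t.
Proof.
exists (idm _), (idm _), (idm _); split; last by split; exact: is_iso_id.
by split; rewrite ?fmap_id ?comp_idl ?comp_idr.
Qed.

Lemma sixtuple_morphism_comp (t1 t2 t3 : sixtuple Sigma)
    (a : Hom (sX t1) (sX t2)) (b : Hom (sY t1) (sY t2)) (c : Hom (sZ t1) (sZ t2))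
    (a' : Hom (sX t2) (sX t3)) (b' : Hom (sY t2) (sY t3))
    (c' : Hom (sZ t2) (sZ t3)) :
  sixtuple_morphism a' b' c' -> sixtuple_morphism a b c ->
  sixtuple_morphism (a' ∘ a) (b' ∘ b) (c' ∘ c).
Proof.
move=> [ab' bc' ca'] [ab bc ca]; split; rewrite ?fmap_comp -mcompA.
- by rewrite ab mcompA ab' mcompA.
- by rewrite bc mcompA bc' mcompA.
- by rewrite ca mcompA ca' mcompA.
Qed.

Lemma sixtuple_morphism_inv (t1 t2 : sixtuple Sigma)
    (a : Hom (sX t1) (sX t2)) (b : Hom (sY t1) (sY t2)) (c : Hom (sZ t1) (sZ t2))
    (a' : Hom (sX t2) (sX t1)) (b' : Hom (sY t2) (sY t1))
    (c' : Hom (sZ t2) (sZ t1)) :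
  a' ∘ a = idm _ -> a ∘ a' = idm _ -> b' ∘ b = idm _ -> b ∘ b' = idm _ ->
  c' ∘ c = idm _ -> c ∘ c' = idm _ ->
  sixtuple_morphism a b c -> sixtuple_morphism a' b' c'.
Proof.
move=> a'K aK b'K bK c'K cK [ab bc ca]; split.
- by rewrite -[RHS]comp_idl -b'K -!mcompA [b ∘ _]mcompA ab -mcompA aK comp_idr.
- by rewrite -[RHS]comp_idl -c'K -!mcompA [c ∘ _]mcompA bc -mcompA bK comp_idr.
- rewrite -[LHS]comp_idr -cK -mcompA [sh t2 ∘ _]mcompA -ca !mcompA.
  by rewrite -fmap_comp a'K fmap_id comp_idl.
Qed.

Lemma sixtuple_iso_sym (t1 t2 : sixtuple Sigma) :
  sixtuple_iso t1 t2 -> sixtuple_iso t2 t1.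
Proof.
move=> [a [b [c [m [[a' [a'K aK]] [b' [b'K bK]] [c' [c'K cK]]]]]]].
exists a', b', c'; split; last by split; [exists a | exists b | exists c].
exact: sixtuple_morphism_inv m.
Qed.

Lemma sixtuple_iso_trans (t1 t2 t3 : sixtuple Sigma) :
  sixtuple_iso t1 t2 -> sixtuple_iso t2 t3 -> sixtuple_iso t1 t3.
Proof.
move=> [a [b [c [m [ai bi ci]]]]] [a' [b' [c' [m' [ai' bi' ci']]]]].
exists (a' ∘ a), (b' ∘ b), (c' ∘ c).
by split; [exact: sixtuple_morphism_comp | split; exact: is_iso_comp].
Qed.

Definition rotate (t : sixtuple Sigma) : sixtuple Sigma :=
  Sixtuple (sg t) (sh t) (- fmap Sigma (sf t)).

Lemma sixtuple_iso_rotate (t1 t2 : sixtuple Sigma) :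
  sixtuple_iso t1 t2 -> sixtuple_iso (rotate t1) (rotate t2).
Proof.
move=> [a [b [c [[ab bc ca] [ai bi ci]]]]].
exists b, c, (fmap Sigma a); split; last by split=> //; exact: is_iso_fmap.
by split=> //=; rewrite compmN compNm -!fmap_comp ab.
Qed.

End Sixtuples.

(** * Right triangulated categories from standard triangles *)

Section StandardTriangles.
Variables (C : additive_category) (Sigma : additive_functor C C).
Variables standard nabla : sixtuple Sigma -> Prop.
Hypothesis nablaP : forall t,
  nabla t <-> exists2 s, standard s & sixtuple_iso t s.

Definition octahedron (X1 Y1 Z1 Y2 Z2 Y3 : C)
    (f1 : Hom X1 Y1) (g1 : Hom Y1 Z1) (h1 : Hom Z1 (Sigma X1))
    (g2 : Hom Y2 Z2) (h2 : Hom Z2 (Sigma X1))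
    (b1 : Hom Y1 Y2) (b2 : Hom Y2 Y3) (b3 : Hom Y3 (Sigma Y1)) :=
  exists (c1 : Hom Z1 Z2) (c2 : Hom Z2 Y3),
    [/\ c1 ∘ g1 = g2 ∘ b1, h2 ∘ c1 = h1, c2 ∘ g2 = b2 &
        b3 ∘ c2 = fmap Sigma f1 ∘ h2] /\
    nabla (Sixtuple c1 c2 (fmap Sigma g1 ∘ b3)).

Hypothesis standard_rotate : forall t, standard t -> nabla (rotate t).
Hypothesis standard_fill : forall t1 t2 a b,
  standard t1 -> standard t2 -> b ∘ sf t1 = sf t2 ∘ a ->
  exists c : Hom (sZ t1) (sZ t2), sixtuple_morphism a b c.
Hypothesis standard_factor : forall t W (e : Hom (sZ t) W),
  standard t -> e ∘ sg t = 0 -> exists e', e = e' ∘ sh t.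
Hypothesis standard_octahedron :
  forall (X Y Y' : C) (f : Hom X Y) (g : Hom Y Y'),
  exists (Z1 : C) (g1 : Hom Y Z1) h1 (Z2 : C) (g2 : Hom Y' Z2) h2
         (Z3 : C) (g3 : Hom Y' Z3) h3,
    [/\ standard (Sixtuple f g1 h1), standard (Sixtuple (g ∘ f) g2 h2),
        standard (Sixtuple g g3 h3) & octahedron f g1 h1 g2 h2 g g3 h3].

Lemma standard_nabla t : standard t -> nabla t.
Proof. by move=> st; apply/nablaP; exists t => //; exact: sixtuple_iso_refl. Qed.

Lemma nabla_iso t1 t2 : sixtuple_iso t1 t2 -> nabla t1 -> nabla t2.
Proof.
move=> t12 /nablaP[s ss t1s]; apply/nablaP; exists s => //.
exact: sixtuple_iso_trans (sixtuple_iso_sym t12) t1s.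
Qed.

Lemma nabla_exists (X Y : C) (f : Hom X Y) :
  exists (Z : C) (g : Hom Y Z) (h : Hom Z (Sigma X)), nabla (Sixtuple f g h).
Proof.
have [Z [g [h [_ [_ [_ [_ [_ [_ [st _ _ _]]]]]]]]]] :=
  standard_octahedron f (idm Y).
by exists Z, g, h; exact: standard_nabla.
Qed.

Lemma nabla_rotate t : nabla t -> nabla (rotate t).
Proof.
move=> /nablaP[s /standard_rotate + /sixtuple_iso_rotate /sixtuple_iso_sym].
by move=> /[swap]; exact: nabla_iso.
Qed.

Lemma nabla_fill t1 t2 (a : Hom (sX t1) (sX t2)) (b : Hom (sY t1) (sY t2)) :
  nabla t1 -> nabla t2 -> b ∘ sf t1 = sf t2 ∘ a ->
  exists c : Hom (sZ t1) (sZ t2), sixtuple_morphism a b c.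
Proof.
move=> /nablaP[s1 ss1 t1s] /nablaP[s2 ss2 t2s] ab.
have [a1 [b1 [c1 [m1 [[a1' [a1K Ka1]] [b1' [b1K Kb1]] _]]]]] := t1s.
have [a2 [b2 [c2 [m2 [[a2' [a2K Ka2]] [b2' [b2K Kb2]] [c2' [c2K Kc2]]]]]]] := t2s.
have [|c m] := @standard_fill s1 s2 (a2 ∘ a ∘ a1') (b2 ∘ b ∘ b1') ss1 ss2.
  have [ab1 _ _] := m1; have [ab2 _ _] := m2.
  have -> : sf s1 = b1 ∘ sf t1 ∘ a1' by rewrite ab1 -mcompA Ka1 comp_idr.
  rewrite !mcompA -ab2 -(mcompA _ b1') b1K comp_idr.
  by rewrite -(mcompA b2) ab mcompA.
exists (c2' ∘ (c ∘ c1)).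
have := sixtuple_morphism_comp (sixtuple_morphism_inv a2K Ka2 b2K Kb2 c2K Kc2 m2)
  (sixtuple_morphism_comp m m1).
by rewrite -!(mcompA _ a) -!(mcompA _ b) -!mcompA a1K b1K !comp_idr !mcompA
  a2K b2K !comp_idl.
Qed.

Lemma nabla_factor t W (e : Hom (sZ t) W) :
  nabla t -> e ∘ sg t = 0 -> exists e', e = e' ∘ sh t.
Proof.
move=> /nablaP[s ss [a [b [c [[_ bc ca] [_ [b' [b'K bK]] [c' [c'K cK]]]]]]]] eg.
have [|e' e'P] := standard_factor (e := e ∘ c') ss.
  have -> : sg s = c ∘ sg t ∘ b' by rewrite bc -mcompA bK comp_idr.
  by rewrite !mcompA -(mcompA e) c'K comp_idr eg comp0m.
exists (e' ∘ fmap Sigma a).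
by rewrite -mcompA ca mcompA -e'P -mcompA c'K comp_idr.
Qed.

(** With e = c - 1 one has e g = 0 and h e = 0.  By the first equation e factors
through h, so by the second e e = 0. *)
Lemma nabla_endo_iso t (c : Hom (sZ t) (sZ t)) :
  nabla t -> c ∘ sg t = sg t -> sh t ∘ c = sh t -> is_iso c.
Proof.
move=> nt cg hc; rewrite -[c](subrKC (idm _)).
have [|e ce] := nabla_factor (e := c - idm _) nt.
  by rewrite mcompDl compNm cg comp_idl subrr.
apply: is_iso_square0; rewrite [X in X ∘ _]ce -mcompA mcompDr compmN hc.
by rewrite comp_idr subrr compm0.
Qed.

Lemma nabla_compare (X Y Z Z' : C) (f : Hom X Y) (g : Hom Y Z) h
    (g' : Hom Y Z') h' :
  nabla (Sixtuple f g h) -> nabla (Sixtuple f g' h') ->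
  exists c : Hom Z Z', c ∘ g = g' /\ h' ∘ c = h.
Proof.
move=> n1 n2.
have [|c [_ cg hc]] :=
  @nabla_fill (Sixtuple f g h) (Sixtuple f g' h') (idm X) (idm Y) n1 n2.
  by rewrite /= comp_idl comp_idr.
exists c; move: cg hc => /=.
by rewrite comp_idr fmap_id comp_idl => -> ->.
Qed.

(** Two completions of f to a triangle map to each other, and both composites are
isomorphisms by [nabla_endo_iso]. *)
Lemma nabla_unique (X Y Z Z' : C) (f : Hom X Y) (g : Hom Y Z) h
    (g' : Hom Y Z') h' :
  nabla (Sixtuple f g h) -> nabla (Sixtuple f g' h') ->
  exists c : Hom Z Z', [/\ is_iso c, c ∘ g = g' & h' ∘ c = h].
Proof.
move=> n1 n2.
have [c [cg hc]] := nabla_compare n1 n2; have [d [dg hd]] := nabla_compare n2 n1.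
exists c; split=> //; apply: (@is_iso_of_retractions _ _ _ _ d).
  by apply: (nabla_endo_iso n1); rewrite /= -?mcompA ?cg // mcompA hd.
by apply: (nabla_endo_iso n2); rewrite /= -?mcompA ?dg // mcompA hc.
Qed.

(** Conjugating the octahedron on standard triangles by the comparison
isomorphisms of [nabla_unique] gives one on the given triangles. *)
Lemma nabla_octahedron (X1 Y1 Z1 Y2 Z2 Y3 : C)
    (f1 : Hom X1 Y1) (g1 : Hom Y1 Z1) (h1 : Hom Z1 (Sigma X1))
    (g2 : Hom Y2 Z2) (h2 : Hom Z2 (Sigma X1))
    (b1 : Hom Y1 Y2) (b2 : Hom Y2 Y3) (b3 : Hom Y3 (Sigma Y1)) :
  nabla (Sixtuple f1 g1 h1) -> nabla (Sixtuple (b1 ∘ f1) g2 h2) ->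
  nabla (Sixtuple b1 b2 b3) -> octahedron f1 g1 h1 g2 h2 b1 b2 b3.
Proof.
move=> n1 n2 n3.
have [W1 [u1 [v1 [W2 [u2 [v2 [W3 [u3 [v3 [s1 s2 s3 oct]]]]]]]]]] :=
  standard_octahedron f1 b1.
have [c1 [i1 cg1 hc1]] := nabla_unique n1 (standard_nabla s1).
have [c2 [i2 cg2 hc2]] := nabla_unique n2 (standard_nabla s2).
have [c3 [i3 cg3 hc3]] := nabla_unique n3 (standard_nabla s3).
have [p [q [[pu vp qu vq] npq]]] := oct.
have [d2 [dK Kd]] := i2; have [d3 [d3K Kd3]] := i3.
exists (d2 ∘ p ∘ c1), (d3 ∘ q ∘ c2); split; first split.
- by rewrite -!mcompA cg1 pu -cg2 !mcompA dK comp_idl.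
- by rewrite -hc2 -!mcompA [c2 ∘ _]mcompA Kd comp_idl mcompA vp hc1.
- by rewrite -!mcompA cg2 qu -cg3 mcompA d3K comp_idl.
- by rewrite -hc3 -!mcompA [c3 ∘ _]mcompA Kd3 comp_idl mcompA vq -hc2 -mcompA.
apply: nabla_iso npq; apply: sixtuple_iso_sym.
exists c1, c2, c3; split=> //; split=> /=.
- by rewrite !mcompA Kd comp_idl.
- by rewrite !mcompA Kd3 comp_idl.
- by rewrite mcompA -fmap_comp cg1 -hc3 mcompA.
Qed.

Proposition standard_right_triangulated :
  (forall X : C,
    nabla (Sixtuple (idm X) (0 : Hom X zob) (0 : Hom zob (Sigma X)))) ->
  right_triangulated nabla.
Proof.
move=> nid; split.
- exact: nabla_iso.
- exact: nabla_exists.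
- exact: nid.
- by move=> X Y Z f g h; exact: nabla_rotate.
- exact: nabla_fill.
- exact: nabla_octahedron.
Qed.

End StandardTriangles.

(** * Cones of factorizations *)

Section HomotopyCategory.
Variables (n : nat) (n_ge2 : (2 <= n)%N) (n_even : ~~ odd n).
Variables (A : additive_category) (T : additive_functor A A).
Variable omega : nat_trans (id_functor A) T.
Hypothesis omegaT : forall X : A, omega (T X) = fmap T (omega X).

Local Notation F := (Fact n_ge2 omega).
Local Notation H := (HFact n_ge2 omega).
Local Notation S := (shift n_ge2 T).
Local Notation susp := (fact_suspension n_ge2 omegaT n_even).
Local Notation Sigma := (suspension n_ge2 omegaT n_even).
Local Notation cone := (cone omegaT n_even).
Local Notation incl := (cone_inj omegaT n_even).
Local Notation proj := (cone_prj omegaT n_even).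
Local Notation triangle := (cone_sixtuple omegaT n_even).

Lemma hclass_comp (X Y Z : F) (g : Hom Y Z) (f : Hom X Y) :
  hclass (g ∘ f) = @mcomp H X Y Z (hclass g) (hclass f).
Proof. exact/esym/qcompE. Qed.

Lemma hclassN (X Y : F) (f : Hom X Y) : hclass (- f) = - hclass f.
Proof. exact: clsN. Qed.

Lemma fmap_suspension_hclass (X Y : F) (f : Hom X Y) :
  fmap Sigma (hclass f) = hclass (fmap susp f).
Proof.
exact: (qfmapE (@suspension_homotopic n n_ge2 A T omega omegaT n_even) f).
Qed.

Lemma hclass_surj (X Y : H) (u : Hom X Y) : exists f : @Hom F X Y, u = hclass f.
Proof. exact: cls_surj. Qed.

Lemma hclassP (X Y : F) (f g : Hom X Y) : hclass f = hclass g <-> homotopic f g.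
Proof. exact: clsP. Qed.

(** Stated with v = psi i_u because in the applications this equation holds
strictly, whereas phi v = i_u, which makes phi a morphism of sixtuples, only
holds up to the homotopy between phi psi and the identity. *)
Lemma retract_cone_triangle (X Y W : F) (u : Hom X Y) (v : Hom Y W)
    (w : Hom W (susp X)) (phi : Hom W (cone u)) (psi : Hom (cone u) W) :
  psi ∘ phi = idm W -> homotopic (idm (cone u)) (phi ∘ psi) ->
  v = psi ∘ incl u -> w = proj u ∘ phi ->
  sixtuple_iso (@Sixtuple H Sigma X Y W (hclass u) (hclass v) (hclass w))
    (triangle u).
Proof.
move=> psiK /hclassP phiK vE wE.
have phi_v : @mcomp H _ _ _ (hclass phi) (hclass v) = hclass (incl u).
  by rewrite vE -hclass_comp mcompA hclass_comp -phiK -hclass_comp comp_idl.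
exists (idm _), (idm _), (hclass phi); split; first split.
- by rewrite comp_idl comp_idr.
- by rewrite comp_idr; exact: phi_v.
- by rewrite fmap_id comp_idl [sh _]/= wE hclass_comp.
split; [exact: is_iso_id | exact: is_iso_id |].
by exists (hclass psi); rewrite -!hclass_comp psiK -phiK.
Qed.

Lemma identity_triangle (X : F) :
  sixtuple_iso (@Sixtuple H Sigma X X zob (idm _) 0 0) (triangle (idm X)).
Proof.
apply: (@retract_cone_triangle X X zob (idm X) 0 0 0 0).
- by rewrite [RHS]zob_initial comp0m.
- exists (inj1 ∘ fmap S prj2); apply: cone_nullhomotopy.
  rewrite (compm0 _ (0 : Hom (zob : F) _)) [LHS]subr0.
  exact: cone_id_contractible.
- by rewrite comp0m.
- by rewrite compm0.
Qed.

Lemma rotated_triangle (X Y : F) (f : Hom X Y) :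
  sixtuple_iso (rotate (triangle f)) (triangle (incl f)).
Proof.
pose phi : Hom (susp X) (cone (incl f)) :=
  @FactHom _ _ _ _ _ (susp X) (cone (incl f)) _ (rot_inP (morP f)).
pose psi : Hom (cone (incl f)) (susp X) :=
  @FactHom _ _ _ _ _ (cone (incl f)) (susp X) _
    (rot_outP (diff X) (diff Y) (mor f)).
rewrite /rotate -[sf _]/(hclass f) fmap_suspension_hclass -hclassN.
apply: (@retract_cone_triangle _ _ _ _ _ _ phi psi).
- by apply: mor_inj; exact: rot_outK.
- exists (inj1 ∘ fmap S (prj2 ∘ prj2)); apply: cone_nullhomotopy.
  exact: rot_inK_homotopy.
- by apply: mor_inj; exact/esym/rot_out_inj2.
- by apply: mor_inj; exact/esym/prj1_rot_in.
Qed.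

Definition fill_hom (X Y X' Y' : F) (f : Hom X Y) (f' : Hom X' Y')
    (a : Hom X X') (b : Hom Y Y') (s : Hom (S (obj X)) (obj Y'))
    (sP : fmap S (mor (b ∘ f) - mor (f' ∘ a))
          = diff Y' ∘ s + fmap S (s ∘ diff X)) : Hom (cone f) (cone f') :=
  @FactHom _ _ _ _ _ (cone f) (cone f') _ (cone_mapP (morP a) (morP b) sP).

Definition is_cone_triangle (t : sixtuple Sigma) :=
  exists (X Y : F) (f : Hom X Y), t = triangle f.

Lemma cone_triangle_fill t1 t2 (a : Hom (sX t1) (sX t2))
    (b : Hom (sY t1) (sY t2)) :
  is_cone_triangle t1 -> is_cone_triangle t2 -> b ∘ sf t1 = sf t2 ∘ a ->
  exists c : Hom (sZ t1) (sZ t2), sixtuple_morphism a b c.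
Proof.
move=> [X [Y [f e1]]] [X' [Y' [f' e2]]]; subst t1 t2.
have [a' ->] := hclass_surj a; have [b' ->] := hclass_surj b.
rewrite [sf _]/= [sf (triangle f')]/= -!hclass_comp => /hclassP [s sP].
exists (hclass (fill_hom sP)); split.
- by rewrite -!hclass_comp; apply/hclassP; exists s.
- rewrite -!hclass_comp; congr hclass; apply: mor_inj; exact: cone_inj2_map.
- rewrite fmap_suspension_hclass -!hclass_comp; congr hclass; apply: mor_inj.
  exact/esym/cone_prj1_map.
Qed.

Lemma cone_triangle_factor t (W : H) (e : Hom (sZ t) W) :
  is_cone_triangle t -> e ∘ sg t = 0 -> exists e', e = e' ∘ sh t.
Proof.
move=> [X [Y [f ef]]]; subst t; have [e' ->] := hclass_surj e.
rewrite -hclass_comp -[0]/(hclass (0 : @Hom F Y W)) => /hclassP[s sP].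
have {}sP : fmap S (mor e' ∘ inj2) = diff W ∘ s + fmap S (s ∘ diff Y).
  by rewrite -sP; congr (fmap S _); rewrite -[LHS]subr0.
exists (hclass (@FactHom _ _ _ _ _ (susp X) W _
  (cone_factorP (morP e') sP (morP f)))).
rewrite -hclass_comp; apply/hclassP; exists (s ∘ fmap S prj2).
exact: cone_factor_homotopy sP.
Qed.

(** The two new maps are the maps of cones of the squares (1, g) and (f, 1), which
commute strictly, so that the zero homotopy serves for both. *)
Lemma cone_octahedron (X Y Z : F) (f : Hom X Y) (g : Hom Y Z) :
  octahedron (cone_triangles n_ge2 omegaT n_even) (hclass f)
    (hclass (incl f)) (hclass (proj f))
    (hclass (incl (g ∘ f))) (hclass (proj (g ∘ f)))
    (hclass g) (hclass (incl g)) (hclass (proj g)).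
Proof.
have s1 : fmap S (mor (g ∘ f) - mor ((g ∘ f) ∘ idm X))
    = diff Z ∘ 0 + fmap S (0 ∘ diff X).
  by rewrite comp_idr subrr compm0 comp0m fmap0 addr0.
have s2 : fmap S (mor (idm Z ∘ (g ∘ f)) - mor (g ∘ f))
    = diff Z ∘ 0 + fmap S (0 ∘ diff X).
  by rewrite comp_idl subrr compm0 comp0m fmap0 addr0.
pose c1 := fill_hom s1; pose c2 := fill_hom s2.
exists (hclass c1), (hclass c2); split.
  split; rewrite ?fmap_suspension_hclass -!hclass_comp; congr hclass;
    apply: mor_inj.
  - exact: cone_inj2_map.
  - by rewrite [LHS]cone_prj1_map fmap_id comp_idl.
  - by rewrite [LHS]cone_inj2_map comp_idr.
  - exact: cone_prj1_map.
exists _, _, c1.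
pose phi : Hom (cone g) (cone c1) :=
  @FactHom _ _ _ _ _ (cone g) (cone c1) _
    (oct_inP (diff X) (diff Y) (diff Z) (mor f) (mor g)).
pose psi : Hom (cone c1) (cone g) :=
  @FactHom _ _ _ _ _ (cone c1) (cone g) _
    (oct_outP (diff Z) (mor g) (morP f)).
rewrite fmap_suspension_hclass -hclass_comp.
apply: (@retract_cone_triangle _ _ _ _ _ _ phi psi).
- by apply: mor_inj; exact: oct_outK.
- exists (inj1 ∘ fmap S (inj1 ∘ prj1 ∘ prj2)); apply: cone_nullhomotopy.
  exact: oct_inK_homotopy.
- by apply: mor_inj; exact/esym/oct_out_inj2.
- by apply: mor_inj; exact/esym/prj1_oct_in.
Qed.

End HomotopyCategory.

Theorem theorem3p7 (n : nat) (n_ge2 : 2 <= n) (n_even : ~~ odd n)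
    (A : additive_category) (T : additive_functor A A)
    (omega : nat_trans (id_functor A) T)
    (omegaT : forall X : A, omega (T X) = fmap T (omega X)) :
  right_triangulated (C := HFact n_ge2 omega)
    (Sigma := suspension n_ge2 omegaT n_even)
    (cone_triangles n_ge2 omegaT n_even).
Proof.
apply: (@standard_right_triangulated _ _
  (@is_cone_triangle n n_ge2 n_even A T omega omegaT)).
- move=> t; split=> [[X [Y [f tf]]] | [_ [X [Y [f ->]]] tf]].
    by exists (cone_sixtuple omegaT n_even f) => //; exists X, Y, f.
  by exists X, Y, f.
- move=> _ [X [Y [f ->]]].
  exists Y, (cone omegaT n_even f), (cone_inj omegaT n_even f).
  exact: rotated_triangle.
- exact: cone_triangle_fill.
- exact: cone_triangle_factor.
- move=> X Y Z u v.
  have [f ->] := hclass_surj u; have [g ->] := hclass_surj v.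
  rewrite -hclass_comp.
  do 9!eexists; split; last exact: cone_octahedron.
  + by exists X, Y, f.
  + by exists X, Z, (g ∘ f).
  + by exists Y, Z, g.
- by move=> X; exists X, X, (@idm (Fact n_ge2 omega) X);
  exact: identity_triangle.
Qed.
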